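(* Let $T$ be a nonexpansive linear operator on a Hilbert space $\mathcal{H}$, and let $f$ be any nonzero element of $\mathcal{H}$. Let $K:\mathbb{N}\to\mathbb{N}$ be any nondecreasing function satisfying $K(n)\ge n$ for every $n$. For $\varepsilon>0$ put $$\rho=\lceil \|f\|/\varepsilon\rceil,\qquad \overline K(i)=i+2^{13}\rho^4\,K\big((i+1)\,K(2i\rho)\,\rho^2\big),\qquad e=2^9\rho^2 .$$ Then for every $\varepsilon>0$ there is an $n$ satisfying $1\le n\le \overline K^{e}(1)$ such that for every $m\in[n,K(n)]$, $\|A_mf-A_nf\|\le\varepsilon$.
   Context: A linear operator $T$ on $\mathcal{H}$ is nonexpansive if $\|Tf\|\le\|f\|$ for all $f\in\mathcal{H}$. For an integer $n\ge1$, $A_nf=\frac1n\sum_{i<n}T^if$ (sum over $0\le i<n$). $\overline K^{e}(1)$ denotes the $e$-fold iterate of $\overline K$ applied to $1$. The interval $[n,K(n)]$ is an interval of integers. *)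

(* Defs.v *)
From HB Require Import structures.
From mathcomp Require Import all_boot all_order all_algebra.
From mathcomp Require Import complex.
From mathcomp Require Import boolp classical_sets reals topology normedtype.

Set Implicit Arguments.
Unset Strict Implicit.
Unset Printing Implicit Defensive.

Import Order.TTheory GRing.Theory Num.Theory.
Import numFieldNormedType.Exports.

Local Open Scope ring_scope.

(* Hilbert spaces may be real or complex; [scalar R k] is the base field. *)
Variant scalar_kind := RealScalars | ComplexScalars.

Definition scalar (R : realType) (k : scalar_kind) : numFieldType :=
  match k with
  | RealScalars => R
  | ComplexScalars => R[i]%C
  end.

Definition scalar_conj (R : realType) (k : scalar_kind) :
    scalar R k -> scalar R k :=
  match k with
  | RealScalars => fun x => x
  | ComplexScalars => fun z : R[i]%C => z^*
  end.

Definition scalar_re (R : realType) (k : scalar_kind) : scalar R k -> R :=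
  match k with
  | RealScalars => fun x => x
  | ComplexScalars => fun z : R[i]%C => complex.Re z
  end.

Record hilbertType (R : realType) (k : scalar_kind) := HilbertType {
  hilbert_sort :> completeNormedModType (scalar R k) ;
  inner : {dot hilbert_sort for @scalar_conj R k} ;
  normr_inner : forall x : hilbert_sort, `|x| ^+ 2 = inner x x
}.

Section HilbertSpace.
Variables (R : realType) (k : scalar_kind) (H : hilbertType R k).

(* The library norm takes its values in the scalar field, hence in R[i] for a
   complex space, where it is a nonnegative real; hnorm is the same norm as an
   element of R. *)
Definition hnorm (f : H) : R := scalar_re `|f|.

Definition nonexpansive (T : H -> H) : Prop := forall f, hnorm (T f) <= hnorm f.

Definition ergodic_avg (T : H -> H) (n : nat) (f : H) : H :=
  n%:R^-1 *: \sum_(i < n) iter i T f.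

End HilbertSpace.

Definition Kbar (rho : nat) (K : nat -> nat) (i : nat) : nat :=
  (i + 2 ^ 13 * rho ^ 4 * K ((i + 1) * K (2 * i * rho) * rho ^ 2))%N.

(* Main.v *)
Require Import Defs.
From HB Require Import structures.
From mathcomp Require Import all_boot all_order all_algebra.
From mathcomp Require Import complex.
From mathcomp Require Import reals topology normedtype.
From mathcomp Require Import zify ring lra.

Import Order.TTheory GRing.Theory Num.Theory.
Import numFieldNormedType.Exports.

Local Open Scope ring_scope.

(** The proof follows Birkhoff's argument for the mean ergodic theorem in
uniformly convex spaces, with the parallelogram law as the form of convexity.

Averaging does not increase norms, and averaging over a long range absorbs
averaging over a shorter one: A_L (A_m g) is within (m / L) ||g|| of A_L g
([avg_avg]).  So if y = A_N f and m, n are much larger than N, the vectors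
A_m f and A_n f are close to A_m y and A_n y, which both have norm at most
||A_N f||.  If moreover L is much larger than m and n, then A_L sends the
midpoint of A_m y and A_n y close to A_L f, so this midpoint has norm at least
about ||A_L f||.  By the parallelogram law, two vectors of norm at most
||A_N f|| whose midpoint has norm at least ||A_L f|| are at squared distance at
most 4 (||A_N f||^2 - ||A_L f||^2); this is [avg_fluctuation].  Hence
everything reduces to finding scales N and L, with L far beyond K (4 rho N),
between which ||A f||^2 drops by at most eps^2 / 32; then n = 4 rho N is stable
up to K n ([avg_stable]).

Such scales occur among the iterates N_j of [Kbar rho K] from 1, since
N_(j+1) is at least 2^13 rho^4 K (4 rho N_j) ([Kbar_ge]).  The quantity
||A_(N_j) f||^2 is nonnegative and starts at most at ||f||^2 <= rho^2 eps^2, so it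
cannot drop by more than eps^2 / 32 at each of 2^9 rho^2 = 512 rho^2 steps
([exists_small_drop]). *)

Set Implicit Arguments.
Unset Strict Implicit.
Unset Printing Implicit Defensive.

(** * The real-valued norm of a Hilbert space *)

(** These facts allow the real and the complex case to be treated at once: on
norms, which are nonnegative scalars, [scalar_re] preserves sums, products and
order. *)
Section ScalarRe.
Variables (R : realType) (k : scalar_kind).
Implicit Types x y : Defs.scalar R k.

Lemma scalar_reD x y : scalar_re (x + y) = scalar_re x + scalar_re y.
Proof. by case: k x y => //= -[a b] [c d]. Qed.

Lemma scalar_re_le x y : x <= y -> scalar_re x <= scalar_re y.
Proof. by case: k x y => //= x y; rewrite lecE => /andP[]. Qed.

Lemma scalar_re0 : scalar_re (0 : Defs.scalar R k) = 0.
Proof. by case: k. Qed.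

Lemma scalar_re1 : scalar_re (1 : Defs.scalar R k) = 1.
Proof. by case: k. Qed.

Lemma scalar_reMn x n : scalar_re (x *+ n) = scalar_re x *+ n.
Proof.
elim: n => [|n IHn]; first by rewrite !mulr0n scalar_re0.
by rewrite !mulrS scalar_reD IHn.
Qed.

(** Over the complex numbers, a scalar that is nonnegative has no imaginary part,
which is what removes the cross term. *)
Lemma scalar_reM x y : 0 <= x -> scalar_re (x * y) = scalar_re x * scalar_re y.
Proof.
case: k x y => //= -[a b] [c d]; rewrite lecE /= => /andP[/eqP -> _].
by rewrite mul0r subr0.
Qed.

End ScalarRe.

Section HilbertNorm.
Variables (R : realType) (k : scalar_kind) (H : hilbertType R k).
Implicit Types x y : H.

Lemma hnorm_ge0 x : 0 <= hnorm x.
Proof. by rewrite -(scalar_re0 R k); apply: scalar_re_le. Qed.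

Lemma hnorm_gt0 x : x != 0 -> 0 < hnorm x.
Proof.
move=> x_neq0; rewrite lt0r hnorm_ge0 andbT.
apply: contra_neq x_neq0 => hx0; apply/eqP; rewrite -normr_eq0; apply/eqP.
have := normr_ge0 x; move: hx0; rewrite /hnorm; move: `|x|.
case: k => //= -[a b] /= ->; rewrite lecE /= => /andP[/eqP -> _] //.
Qed.

Lemma hnorm0 : hnorm (0 : H) = 0.
Proof. by rewrite /hnorm normr0 scalar_re0. Qed.

Lemma hnormN x : hnorm (- x) = hnorm x.
Proof. by rewrite /hnorm normrN. Qed.

Lemma hnormD x y : hnorm (x + y) <= hnorm x + hnorm y.
Proof. by rewrite /hnorm -scalar_reD; apply/scalar_re_le/ler_normD. Qed.

Lemma hnorm_sum n (F : 'I_n -> H) :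
  hnorm (\sum_(i < n) F i) <= \sum_(i < n) hnorm (F i).
Proof.
elim/big_ind2: _ => [|x1 x2 y1 y2 le1 le2|//]; first by rewrite hnorm0.
exact: le_trans (hnormD _ _) (lerD le1 le2).
Qed.

Lemma hnorm_invn n x : hnorm (n%:R^-1 *: x) = n%:R^-1 * hnorm x.
Proof.
have [->|n_gt0] := posnP n; first by rewrite !invr0 scale0r hnorm0 mul0r.
rewrite /hnorm normrZ scalar_reM ?normr_ge0 //; congr (_ * _).
have inv_ge0 : 0 <= n%:R^-1 :> Defs.scalar R k by rewrite invr_ge0.
rewrite ger0_norm //; apply: (mulIf (_ : n%:R != 0)).
  by rewrite pnatr_eq0 -lt0n.
rewrite -{1}(scalar_re1 R k) -scalar_reMn -scalar_reM // mulVf ?scalar_re1; last first.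
  by rewrite pnatr_eq0 -lt0n.
by rewrite mulVf // pnatr_eq0 -lt0n.
Qed.

Lemma parallelogram x y :
  hnorm (x + y) ^+ 2 + hnorm (x - y) ^+ 2 = 2 * (hnorm x ^+ 2 + hnorm y ^+ 2).
Proof.
have sq (z : H) : hnorm z ^+ 2 = scalar_re (inner H z z).
  by rewrite -normr_inner !expr2 scalar_reM.
rewrite !sq -!scalar_reD mulr_natl -scalar_reMn; congr scalar_re.
by rewrite !(linearDl, linearDr, linearNl, linearNr); ring.
Qed.

End HilbertNorm.

(** * Ergodic averages of a nonexpansive map *)

Section ErgodicAverages.
Variables (R : realType) (k : scalar_kind) (H : hilbertType R k).
Variables (T : {linear H -> H}).
Implicit Types g : H.

Local Notation A := (ergodic_avg T).

Lemma iter_is_linear n : linear (iter n T).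
Proof. by elim: n => [|n IHn] c x y //=; rewrite IHn linearP. Qed.

HB.instance Definition _ n :=
  GRing.isLinear.Build _ _ _ _ (iter n T) (iter_is_linear n).

Lemma ergodic_avg_is_linear n : linear (ergodic_avg T n).
Proof.
move=> c x y; rewrite /ergodic_avg.
under eq_bigr do rewrite linearP.
by rewrite big_split /= -scaler_sumr scalerDr !scalerA mulrC.
Qed.

HB.instance Definition _ n :=
  GRing.isLinear.Build _ _ _ _ (ergodic_avg T n) (ergodic_avg_is_linear n).

Hypothesis hT : nonexpansive T.

Lemma hnorm_iter n g : hnorm (iter n T g) <= hnorm g.
Proof. by elim: n => //= n; apply: le_trans; apply: hT. Qed.

Lemma hnorm_avg n g : hnorm (A n g) <= hnorm g.
Proof.
have [->|n_gt0] := posnP n.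
  by rewrite /ergodic_avg invr0 scale0r hnorm0 hnorm_ge0.
rewrite hnorm_invn ler_pdivrMl ?ltr0n //.
apply: le_trans (hnorm_sum _) _.
apply: (@le_trans _ _ (\sum_(i < n) hnorm g)).
  by apply: ler_sum => i _; apply: hnorm_iter.
by rewrite sumr_const card_ord mulr_natl.
Qed.

(** The sums for T g and for g differ only in their two end terms. *)
Lemma avg_shift L g : hnorm (A L (T g) - A L g) <= 2 / L%:R * hnorm g.
Proof.
rewrite /ergodic_avg -scalerBr hnorm_invn mulrAC [_ / _]mulrC ler_wpM2l ?invr_ge0 //.
rewrite -sumrB; under eq_bigr do rewrite -iterSr.
rewrite -(big_mkord xpredT (fun i => iter i.+1 T g - iter i T g)).
rewrite telescope_sumr //.
by have := hnormD (iter L T g) (- iter 0 T g); rewrite hnormN;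
   have := hnorm_iter L g => /= *; lra.
Qed.

Lemma avg_iter L j g :
  hnorm (A L (iter j T g) - A L g) <= (j * 2)%:R / L%:R * hnorm g.
Proof.
elim: j => [|j IHj] /=; first by rewrite subrr hnorm0 mul0n !mul0r.
rewrite -[X in hnorm X](subrKA (A L (iter j T g))).
apply: le_trans (hnormD _ _) _.
rewrite mulSn (natrD _ 2) (mulrDl 2) mulrDl; apply: lerD => //.
apply: le_trans (avg_shift _ _) _.
by rewrite ler_wpM2l ?divr_ge0 ?hnorm_iter.
Qed.

(** A_L (A_m g) - A_L g is the mean over i < m of the vectors
A_L (T^i g) - A_L g, which have norm at most 2 i ||g|| / L.  The
numbers 2 i have mean m - 1, whence the constant 1 in front of m / L; bounding
each term by its worst case would lose a factor 2. *)
Lemma avg_avg L m g :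
  (0 < m)%N -> hnorm (A L (A m g) - A L g) <= m%:R / L%:R * hnorm g.
Proof.
move=> m_gt0.
have -> : A L (A m g) - A L g = m%:R^-1 *: \sum_(i < m) (A L (iter i T g) - A L g).
  rewrite sumrB sumr_const card_ord scalerBr -linear_sum -linearZ.
  by rewrite -[A L g *+ m]scaler_nat scalerA mulVf ?scale1r // pnatr_eq0 -lt0n.
rewrite hnorm_invn ler_pdivrMl ?ltr0n //.
apply: le_trans (hnorm_sum _) _.
apply: (@le_trans _ _ (\sum_(i < m) (i * 2)%:R / L%:R * hnorm g)).
  by apply: ler_sum => i _; apply: avg_iter.
rewrite -mulr_suml -mulr_suml -natr_sum !mulrA -natrM.
rewrite !ler_wpM2r ?hnorm_ge0 ?invr_ge0 // ler_nat.
rewrite -big_distrl /= -(big_mkord xpredT id) bin2_sum muln2.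
by rewrite -geq_half_double bin2 half_leq // leq_mul2l leq_pred orbT.
Qed.

(** The convexity step: A_m y and A_n y, for y = A_N f, lie in the ball of radius
||A_N f||, and their sum has norm at least 2 ||A_L f|| up to an error because
A_L contracts and maps each of them near A_L f. *)
Lemma avg_fluctuation (f : H) N m n L :
    (0 < N)%N -> (0 < m)%N -> (0 < n)%N ->
  hnorm (A m (A N f) - A n (A N f)) ^+ 2 <=
  4 * (hnorm (A N f) ^+ 2 - hnorm (A L f) ^+ 2)
  + 4 * hnorm f ^+ 2 * ((m%:R + N%:R + n%:R + N%:R) / L%:R).
Proof.
move=> N_gt0 m_gt0 n_gt0.
set y := A N f; set D : R := (_ + _) / _.
(* A_L returns A_l y close to A_L f: absorb first A_l, then A_N. *)
have ret l : (0 < l)%N ->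
    hnorm (A L (A l y) - A L f) <= (l%:R + N%:R) / L%:R * hnorm f.
  move=> l_gt0; rewrite -[X in hnorm X](subrKA (A L y)).
  apply: le_trans (hnormD _ _) _; rewrite !mulrDl; apply: lerD; last exact: avg_avg.
  apply: le_trans (avg_avg _ _ _) _ => //.
  by rewrite ler_wpM2l ?divr_ge0 ?hnorm_avg.
have low : 2 * hnorm (A L f) <= hnorm (A m y + A n y) + D * hnorm f.
  have := hnorm_avg L (A m y + A n y); rewrite linearD.
  have := ret m m_gt0; have := ret n n_gt0; rewrite /D.
  set p := A L (A m y); set q := A L (A n y); set r := A L f.
  have := hnormD (p + q) (- (p - r) - (q - r)).
  have := hnormD (- (p - r)) (- (q - r)).
  rewrite !hnormN; have -> : p + q + (- (p - r) - (q - r)) = r + r.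
    by rewrite !opprB addrACA [p + _]addrC [q + _]addrC !subrK.
  have -> : hnorm (r + r) = 2 * hnorm r.
    have -> : r + r = 2%:R *: r by rewrite scaler_nat mulr2n.
    by rewrite /hnorm normrZ scalar_reM // normr_nat scalar_reMn scalar_re1.
  move=> h1 h2 h3 h4 h5; lra.
have := parallelogram (A m y) (A n y).
have := hnorm_avg m y; have := hnorm_avg n y; have := hnorm_avg L f.
move: (hnorm_ge0 (A m y)) (hnorm_ge0 (A n y)) (hnorm_ge0 (A L f)) low.
have : 0 <= D by rewrite divr_ge0 // !addr_ge0.
move: (hnorm f) (hnorm y) (hnorm (A L f)) (hnorm (A m y)) (hnorm (A n y)).
move: (hnorm (_ + _)) (hnorm (_ - _)) D => s d D b a aL p q.
move=> D0 p0 q0 aL0 low aLb qa pa par.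
have s2 : s ^+ 2 >= 4 * aL ^+ 2 - 4 * b ^+ 2 * D.
  (* The tangent inequality at s = 2 aL avoids squaring 2 aL - D b, whose sign
     is unknown. *)
  have : s ^+ 2 >= 4 * s * aL - 4 * aL ^+ 2 by have := sqr_ge0 (s - 2 * aL); nra.
  have : aL * (s + D * b - 2 * aL) >= 0 by rewrite mulr_ge0 // subr_ge0.
  have : D * (b * (b - aL)) >= 0 by rewrite !mulr_ge0 // ?subr_ge0 //; lra.
  nra.
have p2 : p ^+ 2 <= a ^+ 2 by nra.
have q2 : q ^+ 2 <= a ^+ 2 by nra.
lra.
Qed.

(** The error budget: passing from f to A_N f costs eps / 4 at each of m and n,
because both are at least 4 rho N and ||f|| <= rho eps; the remaining eps / 2 is
squared to eps^2 / 4, which leaves room for four times the drop, eps^2 / 8, and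
for the absorption error, eps^2 / 512 when L >= 2^13 rho^4 M. *)
Lemma avg_stable (f : H) (eps : R) (rho N n L M m : nat) :
    0 < eps -> (0 < rho)%N -> hnorm f <= rho%:R * eps ->
    (0 < N)%N -> n = (4 * rho * N)%N -> (n <= m <= M)%N ->
    (2 ^ 13 * rho ^ 4 * M <= L)%N ->
    hnorm (A N f) ^+ 2 - hnorm (A L f) ^+ 2 <= eps ^+ 2 / 32 ->
  hnorm (A m f - A n f) <= eps.
Proof.
move=> eps_gt0 rho_gt0 le_f N_gt0 def_n /andP[le_nm le_mM] le_ML gap.
have n_gt0 : (0 < n)%N by rewrite def_n !muln_gt0 rho_gt0.
have m_gt0 : (0 < m)%N by apply: leq_trans le_nm.
have le_Nn : (N <= n)%N by rewrite def_n leq_pmull // muln_gt0.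
have rho1 : 1 <= rho%:R :> R by rewrite ler1n.
have f_ge0 := hnorm_ge0 f.
have start l : (n <= l)%N -> hnorm (A l (A N f) - A l f) <= eps / 4.
  move=> le_nl; apply: le_trans (avg_avg _ _ _) _ => //.
  have l_gt0 : 0 < l%:R :> R by rewrite ltr0n (leq_trans n_gt0).
  have : 4 * rho%:R * N%:R <= l%:R :> R by rewrite -!natrM ler_nat -def_n.
  move=> le_l; rewrite mulrAC ler_pdivrMr //.
  have : N%:R * hnorm f <= N%:R * (rho%:R * eps) by rewrite ler_wpM2l.
  have : 4 * rho%:R * N%:R * eps <= l%:R * eps by rewrite ler_pM2r.
  lra.
have mid : hnorm (A m (A N f) - A n (A N f)) <= eps / 2.
  rewrite -(@ler_pXn2r _ 2) ?nnegrE ?hnorm_ge0 ?divr_ge0 ?(ltW eps_gt0) //.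
  apply: le_trans (avg_fluctuation f L N_gt0 m_gt0 n_gt0) _.
  have L_gt0 : 0 < L%:R :> R.
    have M_gt0 := leq_trans m_gt0 le_mM.
    by rewrite ltr0n (leq_trans _ le_ML) // 2!muln_gt0 M_gt0 !expn_gt0 rho_gt0.
  have small : 4 * hnorm f ^+ 2 * ((m%:R + N%:R + n%:R + N%:R) / L%:R)
      <= eps ^+ 2 / 512.
    have le_sum : m%:R + N%:R + n%:R + N%:R <= 4 * M%:R :> R.
      by rewrite -!natrD -natrM ler_nat; lia.
    have le_L : 2 ^+ 13 * (rho%:R ^+ 4 * M%:R) <= L%:R :> R.
      by rewrite mulrA -!natrX -!natrM ler_nat.
    have f2 : hnorm f ^+ 2 <= rho%:R ^+ 4 * eps ^+ 2.
      have : hnorm f ^+ 2 <= (rho%:R * eps) ^+ 2.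
        by rewrite lerXn2r ?nnegrE //; nra.
      have : rho%:R ^+ 2 * eps ^+ 2 <= rho%:R ^+ 4 * eps ^+ 2.
        by rewrite ler_wpM2r ?sqr_ge0 // ler_weXn2l.
      by rewrite exprMn => /[swap]; apply: le_trans.
    rewrite [X in X <= _]mulrA ler_pdivrMr //.
    have : 4 * hnorm f ^+ 2 * (m%:R + N%:R + n%:R + N%:R)
           <= 4 * (rho%:R ^+ 4 * eps ^+ 2) * (4 * M%:R).
      by rewrite ler_pM // ?mulr_ge0 ?sqr_ge0 ?addr_ge0 // ler_pM2l.
    have : eps ^+ 2 * (2 ^+ 13 * (rho%:R ^+ 4 * M%:R)) <= eps ^+ 2 * L%:R.
      by rewrite ler_wpM2l ?sqr_ge0.
    lra.
  have -> : (eps / 2) ^+ 2 = eps ^+ 2 / 4 by field.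
  by have := sqr_ge0 eps; lra.
have start_m : hnorm (A m f - A m (A N f)) <= eps / 4.
  by rewrite -hnormN opprB start.
have start_n := start n (leqnn n).
rewrite -(subrKA (A m (A N f)) (A m f)) -(subrKA (A n (A N f)) (A m (A N f))).
apply: le_trans (hnormD _ _) _.
have := hnormD (A m (A N f) - A n (A N f)) (A n (A N f) - A n f).
lra.
Qed.

End ErgodicAverages.

(** * The sequence of scales *)

Lemma exists_small_drop (R : realDomainType) (u : nat -> R) (c : R) (e : nat) :
  0 <= u e -> u 0%N < c *+ e -> exists2 j, (j < e)%N & u j - u j.+1 <= c.
Proof.
elim: e u => [|e IHe] u ue_ge0; first by rewrite mulr0n ltNge ue_ge0.
have [le_c _|gt_c lt_u] := lerP (u 0%N - u 1%N) c; first by exists 0%N.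
have [|j lt_je le_c] := IHe (fun i => u i.+1) ue_ge0; last by exists j.+1.
by rewrite mulrS in lt_u; lra.
Qed.

Section Scales.
Variables (K : nat -> nat) (rho : nat).
Hypotheses (K_ge : forall n, (n <= K n)%N) (rho_gt0 : (0 < rho)%N).

Lemma iter_Kbar_gt0 j : (0 < iter j (Kbar rho K) 1)%N.
Proof. by elim: j => //= j IHj; rewrite /Kbar ltn_addr. Qed.

Lemma iter_Kbar_homo : {homo (fun j => iter j (Kbar rho K) 1) : i j / (i <= j)%N}.
Proof.
by apply: homo_leq leqnn leq_trans _ => j; rewrite /= {2}/Kbar leq_addr.
Qed.

(** The argument of K in [Kbar] is at least 4 rho N as soon as N >= 1, because
K (2 N rho) >= 2 N rho and the factor N + 1 is at least 2. *)
Lemma Kbar_ge (K_nondecreasing : {homo K : m n / (m <= n)%N}) N :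
  (0 < N)%N -> (2 ^ 13 * rho ^ 4 * K (4 * rho * N) <= Kbar rho K N)%N.
Proof.
move=> N_gt0; rewrite /Kbar (leq_trans _ (leq_addl _ _)) //.
rewrite leq_mul2l K_nondecreasing ?orbT //.
rewrite -[leqLHS]muln1 leq_mul ?expn_gt0 ?rho_gt0 //.
have -> : (4 * rho * N = 2 * (2 * N * rho))%N by lia.
by rewrite leq_mul // addn1 ltnS.
Qed.

End Scales.

Theorem theorem2p16 (R : realType) (k : scalar_kind) (H : hilbertType R k)
    (T : {linear H -> H}) (hT : nonexpansive T)
    (f : H) (hf : f != 0)
    (K : nat -> nat)
    (K_nondecreasing : {homo K : m n / (m <= n)%N})
    (K_ge : forall n : nat, (n <= K n)%N)
    (eps : R) (eps_gt0 : 0 < eps) :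
  let rho := `|Num.ceil (hnorm f / eps)|%N in
  let e := (2 ^ 9 * rho ^ 2)%N in
  exists n : nat,
    (1 <= n <= iter e (Kbar rho K) 1)%N /\
    forall m : nat, (n <= m <= K n)%N ->
      hnorm (ergodic_avg T m f - ergodic_avg T n f) <= eps.
Proof.
move=> rho e.
have f_gt0 := hnorm_gt0 hf.
have quot_gt0 : 0 < hnorm f / eps by rewrite divr_gt0.
have ceil_gt0 : 0 < Num.ceil (hnorm f / eps) by rewrite ceil_gt0.
have rho_gt0 : (0 < rho)%N by rewrite absz_gt0 gt_eqF.
have f_le : hnorm f <= rho%:R * eps.
  by rewrite -ler_pdivrMr // natr_absz gtr0_norm // -ceil_le_int.
pose N j := iter j (Kbar rho K) 1%N.
have [||j lt_je gap] := @exists_small_drop _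
  (fun j => hnorm (ergodic_avg T (N j) f) ^+ 2) (eps ^+ 2 / 32) e.
- by rewrite sqr_ge0.
- (* e * eps^2 / 32 = 16 (rho eps)^2, while ||f||^2 <= (rho eps)^2. *)
  rewrite -[ltRHS]mulr_natr /e natrM !natrX.
  have := hnorm_avg hT (N 0%N) f; have := hnorm_ge0 (ergodic_avg T (N 0%N) f).
  have : 0 < rho%:R :> R by rewrite ltr0n.
  move=> rho0 a0 le_a.
  have : hnorm (ergodic_avg T (N 0%N) f) ^+ 2 <= (rho%:R * eps) ^+ 2.
    by rewrite lerXn2r ?nnegrE ?mulr_ge0 ?(ltW eps_gt0) // (le_trans le_a).
  have : 0 < (rho%:R * eps) ^+ 2 by rewrite exprn_gt0 ?mulr_gt0.
  by rewrite exprMn; lra.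
have N_gt0 : (0 < N j)%N by exact: iter_Kbar_gt0.
have le_L := Kbar_ge K_ge rho_gt0 K_nondecreasing N_gt0.
exists (4 * rho * N j)%N; split.
  apply/andP; split; first by rewrite !muln_gt0 rho_gt0.
  apply: (leq_trans _ (@iter_Kbar_homo K rho _ _ lt_je)).
  apply: leq_trans le_L; apply: leq_trans (K_ge _) _.
  by rewrite leq_pmull // muln_gt0 !expn_gt0 rho_gt0.
move=> m m_in.
exact: (avg_stable hT eps_gt0 rho_gt0 f_le N_gt0 erefl m_in le_L gap).
Qed.
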